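(* For every $\delta\in(0,1)$ and $n\in\mathbb N$, $$\widetilde M_{n,\delta}=\sqrt{\frac{n+1}{\delta}} .$$
   Context: $\mathbb T$ is the unit circle, identified with $(-\pi,\pi]$ via $\theta\mapsto e^{i\theta}$. For a finite positive measure $\mu$ on $\mathbb T$ (not necessarily a probability measure) with infinite support, $\phi_n(z,\mu)=\lambda_nz^n+\ldots$, $\lambda_n>0$, are the polynomials orthonormal with respect to $\mu$, and $\mu'$ is the density of the absolutely continuous part of $\mu$ with respect to $d\theta$. Define $$\widetilde M_{n,\delta}=\sup_{\mu'\ge\delta/(2\pi)}\|\phi_n(z,\mu)\|_{L^\infty(\mathbb T)},$$ the supremum being over all finite positive measures $\mu$ on $\mathbb T$ with $\mu'\ge\delta/(2\pi)$ a.e. *)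

(* Defs.v *)
From HB Require Import structures.
From mathcomp Require Import all_boot all_order all_algebra.
From mathcomp Require Import all_classical all_reals all_analysis.
From mathcomp Require Import complex.

Set Implicit Arguments.
Unset Strict Implicit.
Unset Printing Implicit Defensive.

Import Order.TTheory GRing.Theory Num.Theory.
Import numFieldNormedType.Exports.

Local Open Scope classical_set_scope.
Local Open Scope complex_scope.
Local Open Scope ring_scope.

Definition circle (R : realType) : set (measurableTypeR R) := `]- pi, pi].

Lemma measurable_circle (R : realType) : measurable (@circle R).
Proof. exact: measurable_itv. Qed.

Definition dtheta (R : realType) : {measure set (measurableTypeR R) -> \bar R} :=
  mrestr (@lebesgue_measure R) (@measurable_circle R).

Definition expi (R : realType) (t : R) : R[i] := cos t +i* sin t.

Definition cabs (R : realType) (z : R[i]) : R := complex.Re `|z|.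

(* A measure on the unit circle is a Borel measure on R carried by ]-pi, pi]. *)
Definition on_circle (R : realType)
    (mu : {measure set (measurableTypeR R) -> \bar R}) : Prop :=
  mu (~` @circle R) = 0%E.

(* Neighbourhoods are those of the circle: points near -pi are close to pi. *)
Definition circle_support (R : realType)
    (mu : {measure set (measurableTypeR R) -> \bar R}) : set R :=
  [set t | @circle R t /\
     forall e : R, 0 < e ->
       (0 < mu [set s | @circle R s /\ (cabs (expi s - expi t) < e)%R])%E].

Definition mutually_singular d (T : measurableType d) (R : realType)
    (mu nu : {measure set T -> \bar R}) : Prop :=
  exists N : set T, [/\ measurable N, mu N = 0%E & nu (~` N) = 0%E].

(* [w] is (a version of) mu', that is, mu = w dtheta + sigma is the Lebesgue
   decomposition of mu; this determines w up to a dtheta-null set. *)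
Definition ac_density (R : realType)
    (mu : {measure set (measurableTypeR R) -> \bar R})
    (w : measurableTypeR R -> R) : Prop :=
  [/\ measurable_fun setT w, (forall t, 0 <= w t) &
      exists sigma : {measure set (measurableTypeR R) -> \bar R},
        mutually_singular sigma (@dtheta R) /\
        forall A : set (measurableTypeR R), measurable A ->
          (mu A = \int[@dtheta R]_(t in A) (w t)%:E + sigma A)%E].

Definition cintegral (R : realType)
    (mu : {measure set (measurableTypeR R) -> \bar R}) (f : R -> R[i]) : R[i] :=
  (\int[mu]_(t in @circle R) complex.Re (f t)) +i*
  (\int[mu]_(t in @circle R) complex.Im (f t)).

(* phi k has exact degree k; in R[i], [0 < z] means that z is real and
   positive. *)
Definition orthonormal_polynomials (R : realType)
    (mu : {measure set (measurableTypeR R) -> \bar R})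
    (phi : nat -> {poly R[i]}) : Prop :=
  (forall k, size (phi k) = k.+1 /\ 0 < lead_coef (phi k)) /\
  (forall j k,
     cintegral mu (fun t => (phi j).[expi t] * ((phi k).[expi t])^*)
       = (j == k)%:R).

Definition circle_Linfty_norm (R : realType) (p : {poly R[i]}) : \bar R :=
  Lnorm (@dtheta R) +oo%E (fun t => (cabs p.[expi t])%:E).

Definition Mtilde (R : realType) (n : nat) (delta : R) : \bar R :=
  ereal_sup [set x | exists (mu : {finite_measure set (measurableTypeR R) -> \bar R})
                            (w : measurableTypeR R -> R)
                            (phi : nat -> {poly R[i]}),
    [/\ on_circle mu, infinite_set (circle_support mu),
        ac_density mu w /\ {ae @dtheta R, forall t, delta / (2 * pi) <= w t},
        orthonormal_polynomials mu phi &
        x = circle_Linfty_norm (phi n)]].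

(* Main.v *)
From HB Require Import structures.
Require Import Defs.
From mathcomp Require Import all_boot all_order all_algebra.
From mathcomp Require Import all_classical all_reals all_analysis.
From mathcomp Require Import complex measurable_realfun ess_sup_inf ring lra.
Set Implicit Arguments.
Unset Strict Implicit.
Unset Printing Implicit Defensive.
Import Order.TTheory GRing.Theory Num.Theory.
Import numFieldNormedType.Exports.
Local Open Scope classical_set_scope.
Local Open Scope complex_scope.
Local Open Scope ring_scope.

(** Upper bound.  Let [mu' >= delta / (2 pi)].  Parseval gives, for every
    polynomial [p] with coefficients [p_k],
    [int |p|^2 dmu >= delta * sum_k |p_k|^2] ([circle_form_ge]).  Hence the
    [n + 1] coefficients of the orthonormal polynomial [phi_n] satisfy
    [sum_k |p_k|^2 <= 1 / delta], and the Cauchy-Schwarz inequality yields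
    [|phi_n|^2 <= (n + 1) / delta] on the circle ([Mtilde_le]).

    Lower bound.  Equality in Cauchy-Schwarz at the point [-1] forces [phi_n] to
    be proportional to the kernel [sum_(k <= n) (-z)^k], whose zeros are the
    [n] numbers [z <> -1] with [z^(n+1) = (-1)^(n+1)].  To push [phi_n] towards
    this kernel, start from [delta / (2 pi) dtheta] and put a mass [m] on each of
    these zeros.  Together with [-1] they are the nodes of a quadrature formula
    that is exact on the products [p * q^*] with [p, q] of degree at most [n]
    ([sum_expi_roots]); so, with [a = delta + m (n + 1)], the inner product of
    the new measure restricted to degree at most [n] is
        [a * sum_k p_k (q_k)^* - m * p(-1) q(-1)^*]       ([extremal_form]),
    a rank-one perturbation of a multiple of the standard one.  It can be
    inverted by hand: [extremal_poly] is orthogonal to all lower degrees,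
    has squared norm [a * delta * (m + delta)] and modulus [a] at [-1].  After
    normalization this modulus is [sqrt (a / (delta * (m + delta)))], which
    tends to [sqrt ((n + 1) / delta)] when [m] goes to infinity.

    A competitor in the supremum is a whole orthonormal sequence; the degrees
    other than [n] are supplied by [orthonormal_poly_exists].  The uniform norm is
    an essential supremum, which sees point values because polynomials are
    continuous and every neighbourhood of a point of the circle has positive
    length ([circle_Linfty_norm_ge]). *)

(** * Orthonormal polynomials of a positive definite Hermitian form *)

(** The Gram matrix of [1, X, ..., X^(k-1)] is invertible because the form is
    definite, so the projection of [X^k] on lower degrees is found by solving one
    linear system, without the recursion of Gram-Schmidt. *)
Lemma orthonormal_poly_exists (C : numClosedFieldType)
  (B : {poly C} -> {poly C} -> C)
  (Blin : forall a p q r, B (a *: p + q) r = a * B p r + B q r)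
  (Bherm : forall p q, B q p = (B p q)^*)
  (Bpos : forall p, p != 0 -> 0 < B p p) (k : nat) :
  exists p : {poly C}, [/\ size p = k.+1, 0 < lead_coef p,
    forall q : {poly C}, (size q <= k)%N -> B p q = 0 & B p p = 1].
Proof.
have B0 r : B 0 r = 0.
  have := Blin 1 0 0 r; rewrite scaler0 addr0 mul1r => h.
  by apply: (addrI (B 0 r)); rewrite addr0 -h.
have BD p q r : B (p + q) r = B p r + B q r.
  by rewrite -[p in LHS]scale1r Blin mul1r.
have BZ a p r : B (a *: p) r = a * B p r.
  by rewrite -[a *: p]addr0 Blin B0 addr0.
have BrV (v : 'rV[C]_k) r : B (rVpoly v) r = \sum_i v 0 i * B 'X^i r.
  have -> : rVpoly v = \sum_i v 0 i *: 'X^i.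
    rewrite [in LHS](row_sum_delta v) linear_sum.
    by apply: eq_bigr => i _; rewrite linearZ /= rVpoly_delta.
  rewrite (big_morph (fun p => B p r) (fun p q => BD p q r) (B0 r)).
  by apply: eq_bigr => i _; rewrite BZ.
have Bsym0 p q : B p q = 0 -> B q p = 0 by move=> h; rewrite Bherm h rmorph0.
have Bmono p : (forall j : 'I_k, B p 'X^j = 0) ->
    forall q : {poly C}, (size q <= k)%N -> B p q = 0.
  move=> h q sq; apply: (Bsym0); rewrite -(poly_rV_K sq) BrV big1 // => i _.
  by rewrite (Bsym0 _ _ (h i)) mulr0.
pose G := \matrix_(i < k, j < k) B 'X^i 'X^j : 'M[C]_k.
have mulG (v : 'rV[C]_k) j : (v *m G) 0 j = B (rVpoly v) 'X^j.
  by rewrite BrV mxE; apply: eq_bigr => i _; rewrite mxE.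
have Gunit : G \in unitmx.
  rewrite -row_free_unit; apply: inj_row_free => v vG0.
  have /eqP : B (rVpoly v) (rVpoly v) = 0.
    apply: (Bmono) => [j|]; last exact: size_poly.
    by rewrite -mulG vG0 mxE.
  have [v0 _|/Bpos/gt_eqF -> //] := eqVneq (rVpoly v) 0.
  by rewrite -(rVpolyK v) v0 linear0.
pose u := \row_(j < k) B 'X^k 'X^j : 'rV[C]_k.
pose c := - (u *m invmx G).
pose p := 'X^k + rVpoly c.
have sc : (size (rVpoly c) < size ('X^k : {poly C}))%N.
  by rewrite size_polyXn ltnS; exact: size_poly.
have sp : size p = k.+1 by rewrite size_polyDl // size_polyXn.
have lp : lead_coef p = 1 by rewrite lead_coefDl // lead_coefXn.
have porth (q : {poly C}) : (size q <= k)%N -> B p q = 0.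
  apply: (Bmono) => j; rewrite BD -mulG mulNmx mulmxKV // mxE [in X in _ - X]mxE.
  exact: subrr.
have b0 : 0 < B p p by apply: Bpos; rewrite -size_poly_eq0 sp.
have sb0 : 0 < (sqrtC (B p p))^-1 by rewrite invr_gt0 sqrtC_gt0.
exists ((sqrtC (B p p))^-1 *: p); split.
- by rewrite size_scale // gt_eqF.
- by rewrite lead_coefZ lp mulr1.
- by move=> q sq; rewrite BZ (porth q sq) mulr0.
- rewrite BZ (Bherm (_ *: p) p) BZ rmorphM /= -(Bherm p p).
  rewrite conj_Creal ?realE ?(ltW sb0) // mulrA -invfM -expr2 sqrtCK.
  by rewrite mulVf // gt_eqF.
Qed.

(** * The exponential on the circle and a quadrature formula *)

Lemma expiD (R : realType) (a b : R) : expi (a + b) = expi a * expi b.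
Proof. by rewrite /expi cosD sinD addrC; simpc; congr Complex; ring. Qed.

Lemma expi0 (R : realType) : expi (0 : R) = 1.
Proof. by rewrite /expi cos0 sin0. Qed.

Lemma expi_conj (R : realType) (a : R) : (expi a)^* = expi (- a).
Proof. by rewrite /expi cosN sinN. Qed.

Lemma expiX (R : realType) (a : R) (k : nat) : expi a ^+ k = expi (k%:R * a).
Proof.
elim: k => [|k IH]; first by rewrite mul0r expi0.
by rewrite exprS IH -expiD -natr1 mulrDl mul1r addrC.
Qed.

Lemma expipi (R : realType) : expi (pi : R) = -1.
Proof. by rewrite /expi cospi sinpi; simpc. Qed.

Lemma expi_monomial (R : realType) (t : R) (j k : nat) :
  expi t ^+ j * (expi t ^+ k)^* = expi ((j%:R - k%:R) * t).
Proof. by rewrite !expiX expi_conj -expiD mulrBl. Qed.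

Lemma expi_monomial_pi (R : realType) (j k : nat) :
  expi ((j%:R - k%:R) * pi : R) = (-1) ^+ j * (-1) ^+ k.
Proof. by rewrite -expi_monomial expipi !rmorphXn rmorphN rmorph1. Qed.

(** The argument is doubled so that [expi a ^+ 2 = 1], that is [expi a = 1] or
    [expi a = -1], reduces to the vanishing of [sin a]. *)
Lemma expi_double_neq1 (R : realType) (a : R) :
  a != 0 -> `|a| < pi -> expi (2 * a) != 1.
Proof.
move=> a0 api; apply/negP => /eqP; rewrite -expiX => /eqP.
rewrite sqrf_eq1 => /orP h.
have : sin `|a| = 0.
  have -> : `|a| = Num.sg a * a by rewrite -normrEsg.
  by rewrite sin_sg; case: h => /eqP[_ ->]; rewrite ?oppr0 mulr0.
by apply/eqP; rewrite gt_eqF // sin_gt0_pi // normr_gt0 a0.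
Qed.

(** The angles are counted down from [pi] so that all of them, for [i < N], are
    in [ ]-pi, pi] ] and so that [i = 0] is the point [-1]. *)
Definition root_angle (R : realType) (N i : nat) : R :=
  pi - 2 * pi * i%:R / N%:R.

Lemma circle_root_angle (R : realType) (N i : nat) :
  (i < N)%N -> circle (root_angle R N i).
Proof.
move=> iN; have N0 : 0 < N%:R :> R by rewrite ltr0n (leq_ltn_trans _ iN).
have p0 := @pi_gt0 R.
have h1 : 0 <= i%:R / N%:R :> R by rewrite divr_ge0.
have h2 : i%:R / N%:R < 1 :> R by rewrite ltr_pdivrMr // mul1r ltr_nat.
rewrite /circle /root_angle /= in_itv /= -mulrA; apply/andP; split; nra.
Qed.

(** A geometric sum whose ratio is an [N]-th root of unity, equal to [1] only for
    [j = k]: the [N] nodes integrate [z^j * (z^k)^*] exactly, up to the factor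
    [N]. *)
Lemma sum_expi_roots (R : realType) (N j k : nat) : (j < N)%N -> (k < N)%N ->
  \sum_(i < N) expi ((j%:R - k%:R) * root_angle R N i) = (N * (j == k))%:R.
Proof.
move=> jN kN.
have N0 : 0 < N%:R :> R by rewrite ltr0n (leq_ltn_trans _ jN).
have [->|jk] := eqVneq j k.
  under eq_bigr do rewrite subrr mul0r expi0.
  by rewrite sumr_const card_ord muln1.
pose a : R := - ((j%:R - k%:R) * (pi / N%:R)).
have p0 := @pi_gt0 R.
have y1 : expi (2 * a) != 1.
  apply: expi_double_neq1.
    rewrite oppr_eq0 mulf_eq0 negb_or subr_eq0 eqr_nat jk /=.
    by rewrite gt_eqF // divr_gt0.
  rewrite normrN normrM (gtr0_norm (divr_gt0 p0 N0)) mulrA ltr_pdivrMr //.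
  rewrite mulrC ltr_pM2l // ltr_norml.
  have : j%:R < N%:R :> R by rewrite ltr_nat.
  have : k%:R < N%:R :> R by rewrite ltr_nat.
  have := ler0n R j; have := ler0n R k; lra.
have term (i : nat) : expi ((j%:R - k%:R) * root_angle R N i) =
    expi ((j%:R - k%:R) * pi) * expi (2 * a) ^+ i.
  rewrite expiX -expiD /root_angle /a; congr expi; field.
  by rewrite gt_eqF.
under eq_bigr do rewrite term.
rewrite muln0 -mulr_sumr; apply/eqP; rewrite mulf_eq0; apply/orP; right.
have: (expi (2 * a) - 1) * \sum_(i < N) expi (2 * a) ^+ i = 0.
  rewrite -subrX1 expiX (_ : _ * _ = (k%:R - j%:R) * (pi + pi)); last first.
    by rewrite /a; field; rewrite gt_eqF.
  rewrite mulrDr expiD -expr2 expi_monomial_pi exprMn -!exprM -exprD -mulnDl.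
  by rewrite mulnC exprM sqrrN !expr1n subrr.
by move=> /eqP; rewrite mulf_eq0 subr_eq0 (negbTE y1).
Qed.

(** * Trigonometric integrals against the length measure *)

Lemma dtheta_circle (R : realType) : dtheta R (@circle R) = (2 * pi)%:E.
Proof.
rewrite /dtheta /= /mrestr setIid /circle lebesgue_measure_itv /= lte_fin.
by rewrite ifT -?EFinB; [congr EFin; ring|have := @pi_gt0 R; lra].
Qed.

Lemma Rintegral_dtheta (R : realType) (f : R -> R) :
  \int[dtheta R]_(t in @circle R) f t =
  \int[@lebesgue_measure R]_(t in `]- pi, pi]) f t.
Proof.
congr fine; apply: eq_measure_integral => A mA sA.
by rewrite /dtheta /= /mrestr setIidl.
Qed.

Lemma Rintegral_derivative (R : realType) (a b : R) (f F : R -> R) : a < b ->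
  continuous f -> (forall x : R, is_derive x 1 F (f x)) ->
  \int[@lebesgue_measure R]_(t in `]a, b]) f t = F b - F a.
Proof.
move=> ab cf dF.
have cF : continuous F.
  by move=> x; apply/differentiable_continuous/derivable1_diffP; case: (dF x).
have ic : (@lebesgue_measure R).-integrable `[a, b] (EFin \o f).
  apply: continuous_compact_integrable; first exact: segment_compact.
  exact: continuous_subspaceT.
rewrite Rintegral_itv_obnd_cbnd; last first.
  by apply: integrableS ic => //; exact: subset_itv_oc_cc.
rewrite /Rintegral (@continuous_FTC2 _ f F) //.
- exact: continuous_subspaceT.
- split=> [x _||]; first by case: (dF x).
    by apply: cvg_at_right_filter; exact: cF.
  by apply: cvg_at_left_filter; exact: cF.
- by move=> x _; rewrite derive1E; case: (dF x).
Qed.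

(** Orthogonality of the characters of the circle. *)
Lemma cintegral_dtheta_expi (R : realType) (j k : nat) :
  cintegral (dtheta R) (fun t => expi ((j%:R - k%:R) * t)) =
  ((2 * pi) * (j == k)%:R)%:C.
Proof.
rewrite /cintegral /= !Rintegral_dtheta; set r := _ - _.
have ppi : - pi < pi :> R by have := @pi_gt0 R; lra.
have cM : continuous (fun t : R => r * t) by exact: mulrl_continuous.
have [jk|jk] := eqVneq j k.
  have r0 : r = 0 by rewrite /r jk subrr.
  under eq_Rintegral do rewrite r0 mul0r cos0.
  under [in X in _ +i* X]eq_Rintegral do rewrite r0 mul0r sin0.
  rewrite (@Rintegral_derivative _ _ _ (fun=> 1) id) //; last exact: cst_continuous.
  rewrite (@Rintegral_derivative _ _ _ (fun=> 0) (fun=> 0)) //; last first.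
    exact: cst_continuous.
  by simpc; congr Complex; ring.
have r0 : r != 0 by rewrite subr_eq0 eqr_nat.
have sr : sin (r * pi) = 0.
  rewrite /r mulrBl sinB.
  have h i : sin (i%:R * pi : R) = 0.
    by elim: i => [|i IH]; rewrite ?mul0r ?sin0 // -natr1 mulrDl mul1r sinDpi IH oppr0.
  by rewrite !h mul0r mulr0 subrr.
have dr (x : R) : is_derive x 1 (fun t : R => r * t) r.
  by apply: is_derive_eq; rewrite /GRing.scale /= mulr1.
have dS (x : R) : is_derive x 1 (fun t : R => sin (r * t) / r) (cos (r * x)).
  by apply: is_derive_eq; rewrite /GRing.scale /=; field.
have dC (x : R) : is_derive x 1 (fun t : R => - cos (r * t) / r) (sin (r * x)).
  by apply: is_derive_eq; rewrite /GRing.scale /=; field.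
rewrite (@Rintegral_derivative _ _ _ _ _ ppi _ dS); last first.
  by move=> x; apply: continuous_comp; [exact: cM|exact: continuous_cos].
rewrite (@Rintegral_derivative _ _ _ _ _ ppi _ dC); last first.
  by move=> x; apply: continuous_comp; [exact: cM|exact: continuous_sin].
by rewrite !mulrN sinN cosN sr oppr0 !mul0r !subrr mulr0.
Qed.

(** * Complex integrals and the inner product of a measure *)

Lemma ReM (R : realType) (a b : R[i]) :
  complex.Re (a * b) = complex.Re a * complex.Re b - complex.Im a * complex.Im b.
Proof. by case: a; case: b. Qed.

Lemma ImM (R : realType) (a b : R[i]) :
  complex.Im (a * b) = complex.Re a * complex.Im b + complex.Im a * complex.Re b.
Proof. by case: a; case: b. Qed.

Lemma Re_conj (R : realType) (a : R[i]) : complex.Re a^* = complex.Re a.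
Proof. by case: a. Qed.

Lemma Im_conj (R : realType) (a : R[i]) : complex.Im a^* = - complex.Im a.
Proof. by case: a. Qed.

Definition cintegrable (R : realType)
    (mu : {measure set (measurableTypeR R) -> \bar R}) (f : R -> R[i]) :=
  mu.-integrable (@circle R) (EFin \o (fun t => complex.Re (f t))) /\
  mu.-integrable (@circle R) (EFin \o (fun t => complex.Im (f t))).

Section ComplexIntegral.
Variables (R : realType) (mu : {measure set (measurableTypeR R) -> \bar R}).
Implicit Types (f g : R -> R[i]) (a : R[i]).

Let mD : measurable (@circle R) := @measurable_circle R.

Lemma eq_cintegrable f g : f =1 g -> cintegrable mu f -> cintegrable mu g.
Proof. by move=> /funext ->. Qed.

Lemma eq_cintegral f g : f =1 g -> cintegral mu f = cintegral mu g.
Proof. by move=> /funext ->. Qed.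

Lemma cintegrable0 : cintegrable mu (fun=> 0).
Proof. by split; exact: integrable0. Qed.

Lemma cintegral0 : cintegral mu (fun=> 0) = 0.
Proof. by rewrite /cintegral /= /Rintegral integral0. Qed.

Lemma cintegrableD f g : cintegrable mu f -> cintegrable mu g ->
  cintegrable mu (fun t => f t + g t).
Proof.
move=> [fr fi] [gr gi]; split.
  apply: (eq_integrable mD _ _ _ (integrableD mD fr gr)).
  by move=> t _ /=; case: (f t); case: (g t).
apply: (eq_integrable mD _ _ _ (integrableD mD fi gi)).
by move=> t _ /=; case: (f t); case: (g t).
Qed.

Lemma cintegralD f g : cintegrable mu f -> cintegrable mu g ->
  cintegral mu (fun t => f t + g t) = cintegral mu f + cintegral mu g.
Proof.
move=> [fr fi] [gr gi]; rewrite /cintegral; simpc.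
rewrite -!RintegralD //.
by congr Complex; apply: eq_Rintegral => t _; case: (f t); case: (g t).
Qed.

Lemma cintegrableZ a f : cintegrable mu f -> cintegrable mu (fun t => a * f t).
Proof.
move=> [fr fi]; split.
  have h := integrableB mD (integrableZl mD (complex.Re a) fr)
                           (integrableZl mD (complex.Im a) fi).
  by apply: (eq_integrable mD _ _ _ h) => t _ /=; rewrite ReM EFinB !EFinM.
have h := integrableD mD (integrableZl mD (complex.Re a) fi)
                         (integrableZl mD (complex.Im a) fr).
by apply: (eq_integrable mD _ _ _ h) => t _ /=; rewrite ImM EFinD !EFinM.
Qed.

Lemma cintegralZ a f : cintegrable mu f ->
  cintegral mu (fun t => a * f t) = a * cintegral mu f.
Proof.
move=> [fr fi].
have iZ r (g : R -> R) : mu.-integrable (@circle R) (EFin \o g) ->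
    mu.-integrable (@circle R) (EFin \o (fun t => r * g t)).
  by move/(integrableZl mD r); apply: eq_integrable.
apply/eqP; rewrite eq_complex ReM ImM /cintegral /=; apply/andP; split; apply/eqP.
  rewrite -!RintegralZl // -RintegralB //; try exact: iZ.
  by apply: eq_Rintegral => t _; rewrite ReM.
rewrite -!RintegralZl // -RintegralD //; try exact: iZ.
by apply: eq_Rintegral => t _; rewrite ImM.
Qed.

Lemma cintegrable_sum (I : finType) (F : I -> R -> R[i]) :
  (forall i, cintegrable mu (F i)) -> cintegrable mu (fun t => \sum_i F i t).
Proof.
move=> h; elim: (index_enum I) => [|i s IH].
  by apply: (eq_cintegrable _ cintegrable0) => t; rewrite big_nil.
by apply: (eq_cintegrable _ (cintegrableD (h i) IH)) => t; rewrite big_cons.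
Qed.

Lemma cintegral_sum (I : finType) (F : I -> R -> R[i]) :
  (forall i, cintegrable mu (F i)) ->
  cintegral mu (fun t => \sum_i F i t) = \sum_i cintegral mu (F i).
Proof.
move=> h; suff : cintegrable mu (fun t => \sum_(i <- index_enum I) F i t) /\
  cintegral mu (fun t => \sum_(i <- index_enum I) F i t) =
     \sum_(i <- index_enum I) cintegral mu (F i) by case.
elim: (index_enum I) => [|i s [IH1 IH2]].
  split; first by apply: (eq_cintegrable _ cintegrable0) => t; rewrite big_nil.
  by rewrite big_nil -[RHS]cintegral0; apply: eq_cintegral => t; rewrite big_nil.
split.
  by apply: (eq_cintegrable _ (cintegrableD (h i) IH1)) => t; rewrite big_cons.
rewrite big_cons -IH2 -cintegralD //.
by apply: eq_cintegral => t; rewrite big_cons.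
Qed.

Lemma cintegral_conj f : cintegrable mu f ->
  cintegral mu (fun t => (f t)^*) = (cintegral mu f)^*.
Proof.
move=> [_ fi].
apply/eqP; rewrite eq_complex Re_conj Im_conj /cintegral /=; apply/andP; split; apply/eqP.
  by apply: eq_Rintegral => t _; rewrite Re_conj.
rewrite -mulN1r -RintegralZl //.
by apply: eq_Rintegral => t _; rewrite Im_conj mulN1r.
Qed.

Hypothesis mu_fin : (mu (@circle R) < +oo)%E.

Lemma cintegrable_expi (r : R) : cintegrable mu (fun t => expi (r * t)).
Proof.
have cM : continuous (fun t : R => r * t) by exact: mulrl_continuous.
split; apply: measurable_bounded_integrable => // .
- apply: measurable_funTS; apply: continuous_measurable_fun => x.
  by apply: continuous_comp; [exact: cM|exact: continuous_cos].
- exists 1; split; rewrite ?num_real // => M M1 x _.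
  exact: le_trans (cos_max _) (ltW M1).
- apply: measurable_funTS; apply: continuous_measurable_fun => x.
  by apply: continuous_comp; [exact: cM|exact: continuous_sin].
- exists 1; split; rewrite ?num_real // => M M1 x _.
  exact: le_trans (sin_max _) (ltW M1).
Qed.

Implicit Types p q : {poly R[i]}.

Definition circle_form p q : R[i] :=
  cintegral mu (fun t => p.[expi t] * (q.[expi t])^*).

Let horner_expand M p q (t : R) : (size p <= M)%N -> (size q <= M)%N ->
  p.[expi t] * (q.[expi t])^* = \sum_(j < M) \sum_(k < M)
     p`_j * (q`_k)^* * expi ((j%:R - k%:R) * t).
Proof.
move=> sp sq; rewrite (horner_coef_wide _ sp) (horner_coef_wide _ sq).
rewrite rmorph_sum big_distrlr /=; apply: eq_bigr => j _; apply: eq_bigr => k _.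
by rewrite rmorphM /= -expi_monomial mulrACA.
Qed.

Lemma cintegrable_form p q : cintegrable mu (fun t => p.[expi t] * (q.[expi t])^*).
Proof.
pose M := maxn (size p) (size q).
have sp : (size p <= M)%N by exact: leq_maxl.
have sq : (size q <= M)%N by exact: leq_maxr.
apply: (@eq_cintegrable (fun t => \sum_(j < M) \sum_(k < M)
     p`_j * (q`_k)^* * expi ((j%:R - k%:R) * t))).
  by move=> t; rewrite -horner_expand.
apply: cintegrable_sum => j; apply: cintegrable_sum => k.
exact: cintegrableZ (cintegrable_expi _).
Qed.

(** The inner product depends on the measure only through its trigonometric
    moments. *)
Lemma circle_formE M p q : (size p <= M)%N -> (size q <= M)%N ->
  circle_form p q = \sum_(j < M) \sum_(k < M) p`_j * (q`_k)^* *
     cintegral mu (fun t => expi ((j%:R - k%:R) * t)).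
Proof.
move=> sp sq; rewrite /circle_form (eq_cintegral (fun t => horner_expand t sp sq)).
have h (j k : 'I_M) := cintegrableZ (p`_j * (q`_k)^*) (cintegrable_expi (j%:R - k%:R)).
rewrite cintegral_sum => [|j]; last exact: cintegrable_sum.
apply: eq_bigr => j _; rewrite cintegral_sum //.
by apply: eq_bigr => k _; rewrite cintegralZ //; exact: cintegrable_expi.
Qed.

Lemma circle_form_linear a p q r :
  circle_form (a *: p + q) r = a * circle_form p r + circle_form q r.
Proof.
rewrite /circle_form -cintegralZ -?cintegralD //; try exact: cintegrable_form.
  by apply: eq_cintegral => t; rewrite hornerD hornerZ mulrDl mulrA.
by apply: cintegrableZ; exact: cintegrable_form.
Qed.

Lemma circle_form_hermitian p q : circle_form q p = (circle_form p q)^*.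
Proof.
rewrite /circle_form -cintegral_conj; last exact: cintegrable_form.
by apply: eq_cintegral => t; rewrite rmorphM /= conjCK mulrC.
Qed.

End ComplexIntegral.

(** * Modulus and uniform norm of polynomials on the circle *)

Lemma cabsE (R : realType) (z : R[i]) :
  cabs z = Num.sqrt (complex.Re z ^+ 2 + complex.Im z ^+ 2).
Proof. by rewrite /cabs normc_def. Qed.

Lemma cabs_ge0 (R : realType) (z : R[i]) : 0 <= cabs z.
Proof. by rewrite cabsE sqrtr_ge0. Qed.

Lemma mulC_conj (R : realType) (z : R[i]) : z * z^* = (cabs z ^+ 2)%:C.
Proof.
rewrite cabsE sqr_sqrtr ?addr_ge0 ?sqr_ge0 //.
by apply/eqP; rewrite eq_complex ReM ImM Re_conj Im_conj /=; apply/andP; split;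
  apply/eqP; ring.
Qed.

Lemma normC_cabs (R : realType) (z : R[i]) : `|z| = (cabs z)%:C.
Proof. by rewrite normc_def cabsE. Qed.

Lemma cabsM (R : realType) (z w : R[i]) : cabs (z * w) = cabs z * cabs w.
Proof. by apply: complexI; rewrite -normC_cabs normrM !normC_cabs rmorphM. Qed.

Lemma cabs_real (R : realType) (x : R) : 0 <= x -> cabs x%:C = x.
Proof. by move=> x0; rewrite cabsE /= expr0n addr0 sqrtr_sqr ger0_norm. Qed.

Lemma cabs_expi (R : realType) (t : R) : cabs (expi t) = 1.
Proof. by rewrite cabsE /= cos2Dsin2 sqrtr1. Qed.

Lemma sqr_sum_le (R : realFieldType) (M : nat) (a : 'I_M -> R) :
  (\sum_k a k) ^+ 2 <= M%:R * \sum_k a k ^+ 2.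
Proof.
have -> : M%:R * \sum_k a k ^+ 2 =
    \sum_(j < M) \sum_(k < M) (a j ^+ 2 + a k ^+ 2) / 2.
  under [RHS]eq_bigr do rewrite -mulr_suml big_split /= sumr_const card_ord.
  rewrite -mulr_suml big_split /= sumr_const card_ord sumrMnl.
  by rewrite -mulr_natl; field.
rewrite expr2 big_distrlr /=; apply: ler_sum => j _; apply: ler_sum => k _.
by have := sqr_ge0 (a j - a k); rewrite ler_pdivlMr //; nra.
Qed.

Lemma cabs_horner_expi_le (R : realType) (p : {poly R[i]}) (t : R) :
  cabs p.[expi t] ^+ 2 <= (size p)%:R * \sum_(k < size p) cabs p`_k ^+ 2.
Proof.
apply: le_trans (sqr_sum_le _); rewrite ler_sqr ?nnegrE ?cabs_ge0 //; last first.
  by apply: sumr_ge0 => k _; exact: cabs_ge0.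
rewrite -lecR -normC_cabs horner_coef rmorph_sum.
apply: le_trans (ler_norm_sum _ _ _) _; apply: ler_sum => k _.
by rewrite normrM normrX !normC_cabs cabs_expi expr1n mulr1.
Qed.

Lemma continuous_horner_expi (R : realType) (p : {poly R[i]}) :
  continuous (fun t : R => complex.Re p.[expi t]) /\
  continuous (fun t : R => complex.Im p.[expi t]).
Proof.
elim/poly_ind: p => [|p c [cr ci]].
  by split; under eq_fun do rewrite horner0; exact: cst_continuous.
have cs := @continuous_sin R; have cc := @continuous_cos R; split.
  rewrite (_ : (fun t : R => _) = (fun t : R => complex.Re p.[expi t] * cos t -
    complex.Im p.[expi t] * sin t + complex.Re c)); last first.
    by apply/funext => t; rewrite hornerMXaddC raddfD /= ReM.
  move=> t; apply: cvgD; last exact: cvg_cst.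
  by apply: cvgB; apply: cvgM; [exact: cr|exact: cc|exact: ci|exact: cs].
rewrite (_ : (fun t : R => _) = (fun t : R => complex.Re p.[expi t] * sin t +
  complex.Im p.[expi t] * cos t + complex.Im c)); last first.
  by apply/funext => t; rewrite hornerMXaddC raddfD /= ImM.
move=> t; apply: cvgD; last exact: cvg_cst.
by apply: cvgD; apply: cvgM; [exact: cr|exact: cs|exact: ci|exact: cc].
Qed.

Lemma continuous_cabs_horner_expi (R : realType) (p : {poly R[i]}) :
  continuous (fun t : R => cabs p.[expi t]).
Proof.
have [cr ci] := continuous_horner_expi p.
under eq_fun do rewrite cabsE.
move=> t; apply: (@continuous_comp _ _ _
  (fun t : R => complex.Re p.[expi t] ^+ 2 + complex.Im p.[expi t] ^+ 2) Num.sqrt);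
  last exact: sqrt_continuous.
by apply: cvgD; apply: cvgM; [exact: cr|exact: cr|exact: ci|exact: ci].
Qed.

(** A left neighbourhood is used because the endpoint [pi] belongs to the circle
    while [-pi] does not. *)
Lemma dtheta_near_gt0 (R : realType) (t : R) (A : set (measurableTypeR R)) :
  circle t -> measurable A -> nbhs t [set s : R | circle s -> A s] ->
  (0 < dtheta R A)%E.
Proof.
rewrite /circle /= in_itv /= => /andP[t1 t2] mA /nbhs_ballP[e /= e0 hA].
pose I : set R := `]Num.max (- pi) (t - e), t]%classic.
have It : Num.max (- pi) (t - e) < t by rewrite gt_max t1 /=; lra.
apply: (@lt_le_trans _ _ (dtheta R I)); last first.
  have mI : measurable (I : set (measurableTypeR R)) by exact: measurable_itv.
  rewrite /dtheta /= /mrestr; apply: le_measure; rewrite ?inE.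
  - by apply: measurableI => //; exact: measurable_circle.
  - by apply: measurableI => //; exact: measurable_circle.
  move=> s [Is cs]; move: Is; rewrite /I /= in_itv /= gt_max.
  move=> /andP[/andP[s1 s2] s3].
  split=> //; apply: hA => //; rewrite /ball /= ger0_norm; lra.
rewrite /dtheta /= /mrestr setIidl.
  rewrite /I lebesgue_measure_itv /= lte_fin It -EFinB lte_fin; lra.
move=> s; rewrite /I /circle /= !in_itv /= gt_max => /andP[/andP[s1 s2] s3].
by rewrite s1 (le_trans s3).
Qed.

Lemma dthetaT_gt0 (R : realType) : (0 < dtheta R [set: R])%E.
Proof.
apply: (@dtheta_near_gt0 _ pi) => //; last by exists 1 => //=.
by rewrite /circle /= in_itv /= lexx andbT; have := @pi_gt0 R; lra.
Qed.

Lemma circle_Linfty_norm_le (R : realType) (p : {poly R[i]}) (y : R) :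
  (forall t : R, cabs p.[expi t] <= y) -> (circle_Linfty_norm p <= y%:E)%E.
Proof.
move=> h; rewrite /circle_Linfty_norm unlock dthetaT_gt0.
apply/ess_supP; apply: aeW => t /=.
by rewrite lee_fin ger0_norm ?cabs_ge0.
Qed.

(** If the essential supremum were below the value at [t], continuity would put
    a neighbourhood of [t] inside a negligible set. *)
Lemma circle_Linfty_norm_ge (R : realType) (p : {poly R[i]}) (t : R) :
  circle t -> ((cabs p.[expi t])%:E <= circle_Linfty_norm p)%E.
Proof.
move=> ct; rewrite leNgt; apply/negP; rewrite /circle_Linfty_norm unlock dthetaT_gt0.
set s := ess_sup _ _ => slt.
have s0 : (0 <= s)%E.
  apply: ess_sup_gee; first exact: dthetaT_gt0.
  by apply: aeW => u /=; rewrite lee_fin normr_ge0.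
have [r sr] : exists r, s = r%:E.
  by case: (s) s0 slt => [r _ _|//|//]; exists r.
move: slt; rewrite sr lte_fin => rlt.
have [N [mN N0 hN]] := ess_sup_ge (dtheta R) (abse \o (fun t : R => (cabs p.[expi t])%:E)).
suff : (0 < dtheta R N)%E by rewrite N0 ltxx.
apply: (dtheta_near_gt0 ct mN).
have near_gt : \forall u \near t, r < cabs p.[expi u].
  exact: (cvgr_gt _ (@continuous_cabs_horner_expi _ p t) _ rlt).
apply: filterS near_gt => u ru _ /=; apply: hN => /=; rewrite -/s sr lee_fin => h.
by move: ru; rewrite ltNge -(ger0_norm (cabs_ge0 p.[expi u])) h.
Qed.

(** * Comparison with the length measure and the upper bound *)

Lemma dtheta_lty (R : realType) : (dtheta R (@circle R) < +oo)%E.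
Proof. by rewrite dtheta_circle ltry. Qed.

(** Parseval's identity. *)
Lemma circle_form_dtheta (R : realType) (M : nat) (p q : {poly R[i]}) :
  (size p <= M)%N -> (size q <= M)%N ->
  circle_form (dtheta R) p q = (2 * pi)%:C * \sum_(k < M) p`_k * (q`_k)^*.
Proof.
move=> sp sq; rewrite (circle_formE (dtheta_lty R) sp sq) mulr_sumr.
apply: eq_bigr => j _; rewrite (bigD1 j) //= cintegral_dtheta_expi eqxx mulr1.
rewrite big1 ?addr0 1?mulrC // => k kj.
by rewrite cintegral_dtheta_expi eq_sym val_eqE (negbTE kj) !mulr0.
Qed.

Lemma circle_form_sqr (R : realType)
    (mu : {measure set (measurableTypeR R) -> \bar R}) (p : {poly R[i]}) :
  circle_form mu p p = (\int[mu]_(t in @circle R) (cabs p.[expi t] ^+ 2))%:C.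
Proof.
rewrite /circle_form /cintegral; congr Complex.
  by apply: eq_Rintegral => t _; rewrite mulC_conj.
rewrite (_ : \int[mu]_(t in _) _ = \int[mu]_(t in @circle R) 0); last first.
  by apply: eq_Rintegral => t _; rewrite mulC_conj.
by rewrite /Rintegral integral0.
Qed.

(** Compare the integral of the nonnegative function [|p|^2] for the two measures
    and apply Parseval's identity to the smaller one.  The order of complex
    numbers is used: the inequality also says that the right-hand side is real. *)
Lemma circle_form_ge (R : realType)
    (mu : {measure set (measurableTypeR R) -> \bar R}) (c : R)
    (c0 : 0 <= c) (mu_fin : (mu (@circle R) < +oo)%E)
    (mu_ge : forall A, measurable A -> (c%:E * dtheta R A <= mu A)%E)
    (p : {poly R[i]}) :
  (c * (2 * pi) * \sum_(k < size p) cabs p`_k ^+ 2)%:C <= circle_form mu p p.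
Proof.
have intf (nu : {measure set (measurableTypeR R) -> \bar R}) :
    (nu (@circle R) < +oo)%E ->
    nu.-integrable (@circle R) (EFin \o (fun t => cabs p.[expi t] ^+ 2)).
  move=> nu_fin; have [+ _] := cintegrable_form nu_fin p p.
  apply: eq_integrable; first exact: measurable_circle.
  by move=> t _ /=; rewrite mulC_conj.
have mf : measurable_fun setT (EFin \o (fun t => cabs p.[expi t] ^+ 2)).
  apply/measurable_EFinP; apply: continuous_measurable_fun => t.
  by apply: cvgM; exact: continuous_cabs_horner_expi.
have f0 t : (0 <= (cabs p.[expi t] ^+ 2)%:E)%E by rewrite lee_fin sqr_ge0.
have -> : (c * (2 * pi) * \sum_(k < size p) cabs p`_k ^+ 2)%:C =
    c%:C * circle_form (dtheta R) p p.
  rewrite (circle_form_dtheta (leqnn _) (leqnn _)) -mulrA !rmorphM /=.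
  rewrite rmorph_sum; congr (_ * (_ * _)).
  by apply: eq_bigr => k _; rewrite mulC_conj.
rewrite !circle_form_sqr -rmorphM lecR /Rintegral.
have -> : c = fine c%:E by [].
rewrite -fineM //; last first.
  by apply: integrable_fin_num; [exact: measurable_circle|exact/intf/dtheta_lty].
apply: fine_le.
- rewrite fin_numM //; apply: integrable_fin_num; first exact: measurable_circle.
  exact/intf/dtheta_lty.
- by apply: integrable_fin_num; [exact: measurable_circle|exact/intf].
have -> : c%:E = (NngNum c0)%:num%:E by [].
rewrite -ge0_integral_mscale //; try exact: measurable_circle.
  by apply: ge0_le_measure_integral => //; exact: measurable_circle.
exact: measurable_funTS.
Qed.

Lemma ac_density_ge (R : realType)
    (mu : {measure set (measurableTypeR R) -> \bar R})
    (w : measurableTypeR R -> R) (c : R) : 0 <= c ->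
  ac_density mu w -> {ae dtheta R, forall t, c <= w t} ->
  forall A, measurable A -> (c%:E * dtheta R A <= mu A)%E.
Proof.
move=> c0 [mw w0 [sigma [_ muE]]] cw A mA; rewrite muE //.
rewrite -integral_cst //; apply: (@le_trans _ _ (\int[dtheta R]_(t in A) (w t)%:E)%E).
  apply: ae_ge0_le_integral => //.
    by move=> t _; rewrite lee_fin.
  by apply/measurable_EFinP; exact: measurable_funTS.
  by apply: filterS cw => t ct _; rewrite lee_fin.
by rewrite leeDl.
Qed.

Lemma Mtilde_le (R : realType) (delta : R) (n : nat) : 0 < delta ->
  (Mtilde n delta <= (Num.sqrt (n.+1%:R / delta))%:E)%E.
Proof.
move=> d0; apply: ge_ereal_sup => _ [mu [w [phi [_ _ [acw dw] [sphi ophi] ->]]]].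
apply: circle_Linfty_norm_le => t.
have p0 := @pi_gt0 R.
have c0 : 0 <= delta / (2 * pi) by apply/ltW/divr_gt0 => //; exact: mulr_gt0.
have mu_fin : (mu (@circle R) < +oo)%E.
  by rewrite ltey_eq fin_num_measure //; exact: measurable_circle.
have := circle_form_ge c0 mu_fin (ac_density_ge c0 acw dw) (phi n).
rewrite /circle_form ophi eqxx -[1%:R]/(1%:C) lecR divfK ?mulf_neq0 ?gt_eqF //.
rewrite mulrC -ler_pdivlMr // div1r => hsum.
rewrite -[leLHS]ger0_norm ?cabs_ge0 // -sqrtr_sqr ler_sqrt; last first.
  by rewrite divr_ge0 // ltW.
apply: le_trans (cabs_horner_expi_le _ _) _.
by apply: le_trans (ler_wpM2l (ler0n _ _) hsum) _; rewrite (sphi n).1.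
Qed.

(** * The length measure loaded with point masses *)

(** Finiteness is a structure carried by a measure; these declarations attach it
    to a measure whose total mass is known to be finite. *)
Section FiniteCopy.
Variables (R : realType) (nu : {measure set (measurableTypeR R) -> \bar R}).
Hypothesis nu_lty : (nu setT < +oo)%E.

Definition finite_copy of (nu setT < +oo)%E :
  set (measurableTypeR R) -> \bar R := nu.

HB.instance Definition _ := Measure.copy (finite_copy nu_lty) nu.

Let finite_copy_fin : fin_num_fun (finite_copy nu_lty).
Proof. exact: lty_fin_num_fun. Qed.

HB.instance Definition _ := Measure_isFinite.Build _ _ _ (finite_copy nu_lty)
  finite_copy_fin.

Lemma finite_measure_of :
  exists mu : {finite_measure set (measurableTypeR R) -> \bar R},
    forall A, mu A = nu A.
Proof. by exists (finite_copy nu_lty). Qed.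

End FiniteCopy.

(** The index [i.+1] skips the node [root_angle R n.+1 0 = pi], the point [-1]. *)
Definition point_masses (R : realType) (m : {nonneg R}) (n : nat) :
    {measure set (measurableTypeR R) -> \bar R} :=
  mscale m (msum (fun i => \d_(root_angle R n.+1 i.+1 : measurableTypeR R)) n).

Definition loaded_dtheta (R : realType) (c m : {nonneg R}) (n : nat) :
    {measure set (measurableTypeR R) -> \bar R} :=
  measure_add (mscale c (dtheta R)) (point_masses m n).

Lemma point_massesE (R : realType) (m : {nonneg R}) (n : nat) A :
  point_masses m n A =
  (m%:num%:E * \sum_(i < n) \d_(root_angle R n.+1 i.+1) A)%E.
Proof. by []. Qed.

Lemma loaded_dthetaE (R : realType) (c m : {nonneg R}) (n : nat) A :
  loaded_dtheta c m n A = (c%:num%:E * dtheta R A + point_masses m n A)%E.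
Proof. exact: (measure_addE (mscale c (dtheta R)) (point_masses m n)). Qed.

Lemma loaded_dtheta_lty (R : realType) (c m : {nonneg R}) (n : nat) :
  (loaded_dtheta c m n setT < +oo)%E.
Proof.
rewrite loaded_dthetaE ltey_eq fin_numD; apply/orP; left; apply/andP; split.
  rewrite fin_numM //.
  have -> : dtheta R setT = dtheta R (@circle R).
    by rewrite /dtheta /= /mrestr setTI setIid.
  by rewrite dtheta_circle.
rewrite point_massesE fin_numM // sum_fin_num.
by apply/allP => x /mapP[i _ ->]; rewrite diracE.
Qed.

Section ExtremalMeasure.
Variables (R : realType) (delta m : R) (n : nat).
Hypotheses (delta_gt0 : 0 < delta) (m_ge0 : 0 <= m).
Hypothesis c_ge0 : 0 <= delta / (2 * pi).

Let N := n.+1.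
Let c := delta / (2 * pi).
Let a := delta + m * N%:R.
Let atom (i : nat) : R := root_angle R N i.

Let c_gt0 : 0 < c.
Proof. by apply: divr_gt0 => //; apply: mulr_gt0 => //; exact: pi_gt0. Qed.

Let a_gt0 : 0 < a.
Proof. by apply: ltr_pwDl => //; rewrite mulr_ge0. Qed.

Let mD : measurable (@circle R) := @measurable_circle R.

Let atoms := point_masses (NngNum m_ge0) n.
Let nu := loaded_dtheta (NngNum c_ge0) (NngNum m_ge0) n.
Let nuE A : nu A = (c%:E * dtheta R A + atoms A)%E := loaded_dthetaE _ _ _ A.
Let atomsE A : atoms A = (m%:E * \sum_(i < n) \d_(atom i.+1) A)%E :=
  point_massesE _ _ A.

Let circle_atom (i : 'I_n) : circle (atom i.+1).
Proof. by apply: circle_root_angle; rewrite ltnS. Qed.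

Variable mu : {finite_measure set (measurableTypeR R) -> \bar R}.
Hypothesis muE : forall A, mu A = nu A.

Let mu_fin : (mu (@circle R) < +oo)%E.
Proof. by rewrite ltey_eq fin_num_measure. Qed.

Let mu_ge A : measurable A -> (c%:E * dtheta R A <= mu A)%E.
Proof. by move=> mA; rewrite muE nuE leeDl. Qed.

Lemma extremal_on_circle : on_circle mu.
Proof.
rewrite /on_circle [LHS]muE nuE atomsE.
have -> : dtheta R (~` @circle R) = 0%E.
  by rewrite /dtheta /= /mrestr setICl measure0.
rewrite big1 ?mule0 ?adde0 // => i _.
by rewrite diracE memNset // => /(_ (circle_atom i)).
Qed.

(** The singular part is carried by the finite set of atoms. *)
Lemma extremal_ac_density : ac_density mu (fun=> c).
Proof.
split => //; exists atoms; split; last first.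
  by move=> A mA; rewrite [LHS]muE nuE integral_cst.
pose S : set (measurableTypeR R) := \bigcup_(i in [set i | (i < n)%N]) [set atom i.+1].
have mS : measurable S by apply: bigcup_measurable => i _; exact: measurable_set1.
exists (~` S); split; first exact: measurableC.
  rewrite atomsE big1 ?mule0 // => i _.
  by rewrite diracE memNset // => /(_ _); apply; exists i => //=.
rewrite setCK; apply/eqP; rewrite eq_le measure_ge0 andbT.
rewrite /dtheta /= /mrestr.
apply: (@le_trans _ _ (@lebesgue_measure R S)).
  by apply: le_measure; rewrite ?inE //; exact: measurableI.
suff -> : @lebesgue_measure R S = 0%E by [].
apply: countable_lebesgue_measure0.
by apply: bigcup_countable => // i _; exact: countable1.
Qed.

(** The absolutely continuous part alone charges every neighbourhood, so every
    point of the circle is in the support. *)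
Lemma extremal_support_infinite : infinite_set (circle_support mu).
Proof.
suff sub : @circle R `<=` circle_support mu.
  apply: sub_infinite_set sub _; apply: contraPnot (@dtheta_circle R) => fin.
  rewrite /dtheta /= /mrestr setIid.
  rewrite countable_lebesgue_measure0; last exact: finite_set_countable.
  by case => /eqP; rewrite eq_sym mulf_eq0 !gt_eqF // pi_gt0.
move=> t ct; split=> // e e0.
have cd : continuous (fun s : R => cabs (expi s - expi t)).
  have := @continuous_cabs_horner_expi R ('X - (expi t)%:P).
  by under eq_fun do rewrite hornerXsubC.
set A := [set s | _].
have mA : measurable (A : set (measurableTypeR R)).
  rewrite (_ : A = @circle R `&` (fun s : R => cabs (expi s - expi t)) @^-1` `]-oo, e[).
    apply: measurableI => //; rewrite -[X in measurable X]setTI.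
    by apply: (continuous_measurable_fun cd) => //; exact: measurable_itv.
  by apply/seteqP; split=> s; rewrite /A /= in_itv.
apply: (@lt_le_trans _ _ (c%:E * dtheta R A)%E); last exact: mu_ge.
rewrite mule_gt0 ?lte_fin //; apply: (dtheta_near_gt0 ct mA).
have near_lt : \forall s \near t, cabs (expi s - expi t) < e.
  apply: (cvgr_lt _ (cd t)).
  by rewrite subrr cabsE /= expr0n addr0 sqrtr0.
by apply: filterS near_lt => s hs /= cs.
Qed.

Let ge0_integral (g : R -> R) : (forall t, 0 <= g t) -> measurable_fun setT g ->
  (\int[mu]_(t in @circle R) (g t)%:E =
   c%:E * \int[dtheta R]_(t in @circle R) (g t)%:E +
   m%:E * \sum_(i < n) (g (atom i.+1))%:E)%E.
Proof.
move=> g0 mg; rewrite (eq_measure_integral nu) => [|A _ _]; last exact: muE.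
have mgE : measurable_fun (@circle R) (EFin \o g).
  by apply/measurable_EFinP; exact: measurable_funTS.
have gE0 t : @circle R t -> (0 <= (g t)%:E)%E by rewrite lee_fin.
rewrite ge0_integral_measure_add // !ge0_integral_mscale //.
rewrite ge0_integral_measure_sum //; congr (_ + _ * _)%E.
by apply: eq_bigr => i _; rewrite integral_dirac // diracE mem_set ?mul1e.
Qed.

(** The nonnegative case is applied to [g + 1] and to [1], whose difference is
    [g]. *)
Let bounded_integral (g : R -> R) : (forall t, `|g t| <= 1) ->
  measurable_fun setT g ->
  \int[mu]_(t in @circle R) g t =
   c * (\int[dtheta R]_(t in @circle R) g t) + m * \sum_(i < n) g (atom i.+1).
Proof.
have intb (rho : {measure set (measurableTypeR R) -> \bar R}) (h : R -> R) (M : R) :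
    (rho (@circle R) < +oo)%E -> (forall t, `|h t| <= M) ->
    measurable_fun setT h -> rho.-integrable (@circle R) (EFin \o h).
  move=> rho_fin hM mh; apply: measurable_bounded_integrable => //.
    exact: measurable_funTS.
  by exists M; split; rewrite ?num_real // => K MK t _; exact: le_trans (hM t) (ltW MK).
have pos (h : R -> R) (M : R) : (forall t, 0 <= h t) -> (forall t, `|h t| <= M) ->
    measurable_fun setT h -> \int[mu]_(t in @circle R) h t =
    c * (\int[dtheta R]_(t in @circle R) h t) + m * \sum_(i < n) h (atom i.+1).
  move=> h0 hM mh; rewrite [LHS]/Rintegral ge0_integral //.
  have fin : (\int[dtheta R]_(t in @circle R) (h t)%:E)%E \is a fin_num.
    by apply: integrable_fin_num => //; apply: (intb _ _ M) => //; exact: dtheta_lty.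
  rewrite -[X in (c%:E * X)%E]fineK // sumEFin -!EFinM -EFinD.
  by [].
move=> g1 mg.
have int1 (rho : {measure set (measurableTypeR R) -> \bar R}) :
    (rho (@circle R) < +oo)%E -> rho.-integrable (@circle R) (EFin \o (fun=> 1)).
  by move=> rho_fin; apply: (intb _ _ 1) => // t; rewrite normr1.
have intg (rho : {measure set (measurableTypeR R) -> \bar R}) :
    (rho (@circle R) < +oo)%E -> rho.-integrable (@circle R) (EFin \o g).
  by move=> rho_fin; apply: (intb _ _ 1).
have norm1_le (t : R) : `|1 : R| <= 1 by rewrite normr1.
have pos1 := pos (fun=> 1) 1 (fun=> ler01) norm1_le (measurable_cst _).
have : \int[mu]_(t in @circle R) (g t + 1) =
    c * (\int[dtheta R]_(t in @circle R) (g t + 1)) +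
    m * \sum_(i < n) (g (atom i.+1) + 1).
  apply: (pos _ 2) => [t|t|].
  - by move: (g1 t); rewrite ler_norml -lerBlDr sub0r => /andP[].
  - by apply: le_trans (ler_normD _ _) _; rewrite normr1 lerD2r.
  - exact: measurable_funD.
have dfin := dtheta_lty R.
rewrite !RintegralD //; [|exact: intg|exact: int1|exact: intg|exact: int1].
rewrite pos1 big_split /= => h.
apply: (addIr (c * (\int[dtheta R]_(t in @circle R) 1) + m * \sum_(i < n) 1)).
by rewrite h; ring.
Qed.

Let cintegral_expi (r : R) : cintegral mu (fun t => expi (r * t)) =
  c%:C * cintegral (dtheta R) (fun t => expi (r * t)) +
  m%:C * \sum_(i < n) expi (r * atom i.+1).
Proof.
have cM : continuous (fun t : R => r * t) by exact: mulrl_continuous.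
have mcos : measurable_fun setT (fun t : R => cos (r * t)).
  apply: continuous_measurable_fun => t.
  by apply: continuous_comp; [exact: cM|exact: continuous_cos].
have msin : measurable_fun setT (fun t : R => sin (r * t)).
  apply: continuous_measurable_fun => t.
  by apply: continuous_comp; [exact: cM|exact: continuous_sin].
have hc := bounded_integral (fun t => cos_max (r * t)) mcos.
have hs := bounded_integral (fun t => sin_max (r * t)) msin.
apply/eqP; rewrite eq_complex !raddfD /= ReM ImM /= !mul0r subr0 addr0.
rewrite !raddf_sum /cintegral /=.
by apply/andP; split; apply/eqP; [rewrite hc; ring|rewrite hs; ring].
Qed.

(** The atoms are all nodes of the quadrature but one, whence the subtracted term
    [(-1)^j * (-1)^k], the contribution of the missing node [-1]. *)
Let moment (j k : nat) : (j < N)%N -> (k < N)%N ->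
  cintegral mu (fun t => expi ((j%:R - k%:R) * t)) =
  a%:C * (j == k)%:R - m%:C * ((-1) ^+ j * (-1) ^+ k).
Proof.
move=> jN kN; rewrite cintegral_expi cintegral_dtheta_expi.
have := sum_expi_roots R jN kN.
rewrite big_ord_recl /root_angle mulr0 mul0r subr0 expi_monomial_pi => h.
have -> : \sum_(i < n) expi ((j%:R - k%:R) * atom i.+1) =
    (N * (j == k))%:R - (-1) ^+ j * (-1) ^+ k.
  by rewrite -h addrAC subrr add0r; apply: eq_bigr.
have pi0 : 2 * pi != 0 :> R by rewrite gt_eqF // mulr_gt0 ?pi_gt0.
rewrite -rmorphM (_ : c * _ = delta * (j == k)%:R); last first.
  by rewrite /c mulrA divfK.
rewrite natrM !rmorphM /= rmorphD rmorphM /= !rmorph_nat; ring.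
Qed.

(** Completing the atoms by the missing node turns their contribution into
    [m * N] times the standard inner product of coefficients. *)
Lemma extremal_form (p q : {poly R[i]}) : (size p <= N)%N -> (size q <= N)%N ->
  circle_form mu p q =
  a%:C * (\sum_(k < N) p`_k * (q`_k)^*) - m%:C * p.[-1] * (q.[-1])^*.
Proof.
move=> sp sq; rewrite (circle_formE mu_fin sp sq).
rewrite (horner_coef_wide _ sp) (horner_coef_wide _ sq) rmorph_sum.
rewrite -mulrA big_distrlr /= !mulr_sumr -sumrB; apply: eq_bigr => j _.
rewrite (eq_bigr (fun k : 'I_N => a%:C * (p`_j * (q`_k)^* * (j == k)%:R) -
    m%:C * (p`_j * (-1) ^+ j * (q`_k * (-1) ^+ k)^*))); last first.
  move=> k _; rewrite moment // rmorphM rmorphXn rmorphN rmorph1 /=; ring.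
rewrite sumrB -!mulr_sumr (bigD1 j) //= eqxx mulr1 big1 ?addr0 // => k kj.
by rewrite eq_sym (negbTE kj) mulr0.
Qed.

(** * The extremal polynomial and the lower bound *)

(** Orthogonality to [1, z, ..., z^(n-1)] for the rank-one perturbed form says
    that [a * p_k = m * p(-1) * (-1)^k] for [k < n]; this is the solution with
    [p(-1) = (-1)^n * a], a multiple of the kernel at [-1] with [delta] added
    to the leading coefficient, signed so that the latter is positive. *)
Definition extremal_poly : {poly R[i]} :=
  \poly_(k < N) (m%:C * (-1) ^+ (k + n) + delta%:C *+ (k == n)).

Let sign_double i : (-1) ^+ i.*2 = 1 :> R[i].
Proof. by rewrite -signr_odd odd_double. Qed.

Let coef_extremal k : (k < N)%N ->
  extremal_poly`_k = m%:C * (-1) ^+ (k + n) + delta%:C *+ (k == n).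
Proof. by move=> kN; rewrite coef_poly kN. Qed.

Let coef_extremal_n : extremal_poly`_n = (m + delta)%:C.
Proof.
rewrite coef_extremal // eqxx mulr1n addnn sign_double mulr1.
by rewrite rmorphD.
Qed.

Let md_gt0 : 0 < m + delta.
Proof. exact: ltr_wpDl. Qed.

Lemma size_extremal_poly : size extremal_poly = N.
Proof.
apply: size_poly_eq; rewrite -coef_extremal // coef_extremal_n.
by rewrite gt_eqF // ltcR.
Qed.

Lemma lead_coef_extremal_poly : lead_coef extremal_poly = (m + delta)%:C.
Proof. by rewrite lead_coefE size_extremal_poly coef_extremal_n. Qed.

Lemma extremal_poly_N1 : extremal_poly.[-1] = (-1) ^+ n * a%:C.
Proof.
rewrite horner_poly big_ord_recr /= eqxx mulr1n.
rewrite (eq_bigr (fun=> (-1) ^+ n * m%:C)) => [|k _]; last first.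
  rewrite ltn_eqF // addr0 -mulrA -exprD addnAC addnn exprD.
  by rewrite sign_double mul1r mulrC.
rewrite sumr_const card_ord addnn sign_double mulr1 -mulr_natr.
rewrite /a rmorphD rmorphM /= rmorph_nat -natr1; ring.
Qed.

(** The perturbation cancels the kernel part exactly; only the corrected leading
    coefficient contributes. *)
Lemma extremal_form_poly (q : {poly R[i]}) : (size q <= N)%N ->
  circle_form mu extremal_poly q = (a * delta)%:C * (q`_n)^*.
Proof.
move=> sq; rewrite extremal_form ?size_extremal_poly // extremal_poly_N1.
have -> : \sum_(k < N) extremal_poly`_k * (q`_k)^* =
    m%:C * (-1) ^+ n * (q.[-1])^* + delta%:C * (q`_n)^*.
  rewrite (horner_coef_wide _ sq) rmorph_sum mulr_sumr.
  rewrite !big_ord_recr /= -addrA; congr (_ + _).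
    apply: eq_bigr => k _; rewrite coef_extremal ?ltnS 1?ltnW //.
    rewrite ltn_eqF // addr0 exprD rmorphM rmorphXn rmorphN rmorph1; ring.
  rewrite coef_extremal // eqxx mulr1n rmorphM rmorphXn rmorphN rmorph1 exprD.
  by ring.
rewrite rmorphM /=; ring.
Qed.

Let s := Num.sqrt (a * delta * (m + delta)).

Let s_gt0 : 0 < s.
Proof. by rewrite sqrtr_gt0 !mulr_gt0. Qed.

(** The polynomial of degree [n] is prescribed; in the other degrees any unit
    vector orthogonal to lower degrees will do, as each orthogonality relation
    only involves the polynomial of larger degree. *)
Lemma extremal_family : exists phi : nat -> {poly R[i]},
  orthonormal_polynomials mu phi /\ phi n = (s^-1)%:C *: extremal_poly.
Proof.
have pos p : p != 0 -> 0 < circle_form mu p p.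
  move=> p0; apply: lt_le_trans (circle_form_ge c_ge0 mu_fin mu_ge p).
  have pi2_gt0 : 0 < 2 * pi :> R by rewrite mulr_gt0 ?pi_gt0.
  rewrite ltcR; apply: mulr_gt0; first exact: mulr_gt0.
  have sp : ((size p).-1 < size p)%N by rewrite ltn_predL size_poly_gt0.
  rewrite (bigD1 (Ordinal sp)) //= ltr_pwDl ?sumr_ge0 // => [|k _]; last first.
    exact: sqr_ge0.
  by rewrite exprn_gt0 // -ltcR -normC_cabs normr_gt0 -lead_coefE lead_coef_eq0.
pose P k (p : {poly R[i]}) := [/\ size p = k.+1, 0 < lead_coef p,
  forall q : {poly R[i]}, (size q <= k)%N -> circle_form mu p q = 0 &
  circle_form mu p p = 1].
have formZ b p q : circle_form mu (b *: p) q = b * circle_form mu p q.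
  have form0 : circle_form mu 0 q = 0.
    rewrite /circle_form -[RHS](cintegral0 mu); apply: eq_cintegral => t.
    by rewrite horner0 mul0r.
  by have := circle_form_linear mu_fin b p 0 q; rewrite addr0 form0 addr0.
have Pn : P n ((s^-1)%:C *: extremal_poly).
  have s0 : 0 < (s^-1)%:C by rewrite ltcR invr_gt0.
  split.
  - by rewrite size_scale ?size_extremal_poly // gt_eqF.
  - by rewrite lead_coefZ lead_coef_extremal_poly mulr_gt0 // ltcR.
  - move=> q sq; rewrite formZ extremal_form_poly; last exact: leq_trans sq _.
    by rewrite nth_default // rmorph0 !mulr0.
  - rewrite formZ extremal_form_poly; last first.
      by rewrite size_scale ?size_extremal_poly // gt_eqF.
    rewrite coefZ coef_extremal_n -rmorphM.
    rewrite (_ : ((s^-1 * (m + delta))%:C)^* = (s^-1 * (m + delta))%:C); last first.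
      exact: conjc_real.
    have s2 : s ^+ 2 = a * delta * (m + delta) by rewrite sqr_sqrtr // ltW // !mulr_gt0.
    have s1 : s^-1 * (a * delta * (s^-1 * (m + delta))) = 1.
      rewrite [LHS](_ : _ = a * delta * (m + delta) / s ^+ 2); last first.
        by rewrite expr2 invfM; ring.
      by rewrite -s2 divff // gt_eqF // exprn_gt0.
    by rewrite -!rmorphM s1.
have /boolp.choice [phi phiP] : forall k, exists p : {poly R[i]},
    P k p /\ (k = n -> p = (s^-1)%:C *: extremal_poly).
  move=> k; have [->|kn] := eqVneq k n; first by exists ((s^-1)%:C *: extremal_poly).
  have [p Pp] := orthonormal_poly_exists (circle_form_linear mu_fin)
    (circle_form_hermitian mu_fin) pos k.
  by exists p; split=> // /eqP; rewrite (negbTE kn).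
exists phi; split; last by case: (phiP n) => _; exact.
split=> [k|j k]; first by have [[]] := phiP k.
rewrite -/(circle_form mu (phi j) (phi k)).
have orth i l : (i < l)%N -> circle_form mu (phi l) (phi i) = 0.
  move=> il; have [[_ _ o _] _] := phiP l; apply: o.
  by have [[-> _ _ _] _] := phiP i.
have [jk|kj|->] := ltngtP j k.
- by rewrite circle_form_hermitian // orth // rmorph0.
- by rewrite orth.
- by have [[_ _ _ ->] _] := phiP k.
Qed.

Lemma extremal_le_Mtilde :
  ((Num.sqrt (a / (delta * (m + delta))))%:E <= Mtilde n delta)%E.
Proof.
have [phi [ophi phin]] := extremal_family.
have cpi : circle (pi : R).
  by rewrite /circle /= in_itv /= lexx andbT; have := @pi_gt0 R; lra.
apply: (@le_trans _ _ (circle_Linfty_norm (phi n))); last first.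
  apply: ereal_sup_ubound; exists mu, (fun=> c), phi; split=> //.
  - exact: extremal_on_circle.
  - exact: extremal_support_infinite.
  - by split; [exact: extremal_ac_density|exact: aeW].
apply: le_trans (circle_Linfty_norm_ge (phi n) cpi).
rewrite lee_fin phin hornerZ expipi extremal_poly_N1 !cabsM.
rewrite !cabs_real ?invr_ge0 ?(ltW s_gt0) ?(ltW a_gt0) //.
rewrite (_ : cabs ((-1) ^+ n) = 1) ?mul1r; last first.
  by apply: complexI; rewrite -normC_cabs normrX normrN1 expr1n.
rewrite -[leRHS]ger0_norm ?mulr_ge0 ?invr_ge0 ?(ltW s_gt0) ?(ltW a_gt0) //.
rewrite -sqrtr_sqr exprMn exprVn sqr_sqrtr; last by rewrite ltW // !mulr_gt0.
suff -> : (a * delta * (m + delta))^-1 * a ^+ 2 = a / (delta * (m + delta)) by [].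
by field; rewrite !gt_eqF.
Qed.

End ExtremalMeasure.

Lemma Mtilde_ge_loaded (R : realType) (delta m : R) (n : nat) :
  0 < delta -> 0 <= m ->
  ((Num.sqrt ((delta + m * n.+1%:R) / (delta * (m + delta))))%:E
    <= Mtilde n delta)%E.
Proof.
move=> d0 m0; have c0 : 0 <= delta / (2 * pi).
  by apply/ltW/divr_gt0 => //; rewrite mulr_gt0 ?pi_gt0.
have [mu muE] := finite_measure_of (loaded_dtheta_lty (NngNum c0) (NngNum m0) n).
exact: (extremal_le_Mtilde d0 muE).
Qed.

(** If the supremum were a real [y < sqrt (n.+1 / delta)], then a large enough
    mass would contradict the previous bound. *)
Lemma Mtilde_ge (R : realType) (delta : R) (n : nat) : 0 < delta ->
  ((Num.sqrt (n.+1%:R / delta))%:E <= Mtilde n delta)%E.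
Proof.
move=> d0; rewrite leNgt; apply/negP => lt_sup.
have [y My y0] : exists2 y, Mtilde n delta = y%:E & 0 <= y.
  have := Mtilde_ge_loaded n d0 (lexx 0); case: (Mtilde n delta) lt_sup => [y|//|//] _.
  by rewrite lee_fin => h; exists y => //; exact: le_trans (sqrtr_ge0 _) h.
have gap : 0 < n.+1%:R - y ^+ 2 * delta.
  rewrite subr_gt0 -ltr_pdivlMr // -(ger0_norm y0) -sqrtr_sqr.
  rewrite sqr_sqrtr ?sqr_ge0 // -ltr_sqrt ?divr_gt0 //.
  by rewrite sqrtr_sqr ger0_norm // -lte_fin -My.
(* This mass solves [m * (n.+1 - y^2 * delta) = y^2 * delta^2], while beating [y]
   only requires [m * (n.+1 - y^2 * delta) > y^2 * delta^2 - delta]. *)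
pose m := y ^+ 2 * delta ^+ 2 / (n.+1%:R - y ^+ 2 * delta).
have m0 : 0 <= m by apply: divr_ge0; [rewrite mulr_ge0 ?sqr_ge0|exact: ltW].
have mE : m * (n.+1%:R - y ^+ 2 * delta) = y ^+ 2 * delta ^+ 2.
  by rewrite divfK // gt_eqF.
have := Mtilde_ge_loaded n d0 m0; rewrite My lee_fin leNgt => /negP; apply.
have md0 : 0 < delta * (m + delta) by rewrite mulr_gt0 // ltr_wpDl.
rewrite -(ger0_norm y0) -sqrtr_sqr ltr_sqrt; last first.
  by rewrite divr_gt0 // ltr_pwDl // mulr_ge0.
rewrite ltr_pdivlMr //; nra.
Qed.

Theorem theorem2p1 (R : realType) (delta : R) (n : nat)
  (delta_gt0 : 0 < delta) (delta_lt1 : delta < 1) :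
  Mtilde n delta = (Num.sqrt (n.+1%:R / delta))%:E.
Proof. by apply/eqP; rewrite eq_le Mtilde_le ?Mtilde_ge. Qed.
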